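(* For all $n,s\in\mathbb{N}$, $\mathrm{sat}^{*}\left(n,\mathcal{K}_{s,2}\right)\geq n+1$.
   Context: For $n\in\mathbb{N}$, $[n]=\{1,\dots,n\}$ and $2^{[n]}$ is the family of all subsets of $[n]$. For posets $\mathcal{P}$ and $\mathcal{Q}$, $\mathcal{Q}$ contains an induced copy of $\mathcal{P}$ if there is an injective map $f:\mathcal{P}\to\mathcal{Q}$ with $f(x)\preceq_{\mathcal{Q}}f(y)$ if and only if $x\preceq_{\mathcal{P}}y$. The complete bipartite poset $\mathcal{K}_{s,t}$ consists of $s$ pairwise incomparable elements (upper layer) and $t$ pairwise incomparable elements (lower layer), where every upper element is larger than every lower element, and there are no other relations. A family $\mathcal{F}\subseteq 2^{[n]}$ is induced $\mathcal{P}$-saturated if $(\mathcal{F},\subseteq)$ contains no induced copy of $\mathcal{P}$, but for every $F\in 2^{[n]}\setminus\mathcal{F}$ the poset $(\mathcal{F}\cup\{F\},\subseteq)$ contains an induced copy of $\mathcal{P}$. $\mathrm{sat}^{*}(n,\mathcal{P})$ denotes the minimum size of an induced $\mathcal{P}$-saturated family $\mathcal{F}\subseteq 2^{[n]}$. *)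

(* Defs.v *)
From HB Require Import structures.
From mathcomp Require Import all_boot all_order.

Set Implicit Arguments.
Unset Strict Implicit.
Unset Printing Implicit Defensive.

Import Order.TTheory.
Import Order.DefaultSetSubsetOrder.

(* The subposet of Q carried by A contains an induced copy of P. *)
Definition has_induced_copy d d' (P : finPOrderType d) (Q : finPOrderType d')
    (A : {set Q}) : bool :=
  [exists f : {ffun P -> Q},
    [&& injectiveb f, [forall x, f x \in A]
      & [forall x, forall y, (f x <= f y)%O == (x <= y)%O]]].

Arguments has_induced_copy {d d'} P {Q} A.

(* {set 'I_n} is ordered by inclusion through DefaultSetSubsetOrder; the ground
   set is {0, ..., n-1} instead of {1, ..., n}. *)
Definition induced_saturated d (P : finPOrderType d) (n : nat)
    (F : {set {set 'I_n}}) : bool :=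
  ~~ has_induced_copy P F &&
  [forall X, (X \notin F) ==> has_induced_copy P (X |: F)%SET].

Arguments induced_saturated {d} P {n} F.

(* The default value 2 ^ n of the iterated minimum is an upper bound on the size
   of every family, so it is harmless as soon as a saturated family exists;
   this is always the case when P is nonempty (sat_starP). *)
Definition sat_star d (n : nat) (P : finPOrderType d) : nat :=
  \big[minn/2 ^ n]_(F : {set {set 'I_n}} | induced_saturated P F) #|F|.

Section SatStarSpec.
Variables (d : Order.disp_t) (n : nat) (P : finPOrderType d).
Implicit Types F : {set {set 'I_n}}.

Lemma sat_star_le F : induced_saturated P F -> sat_star n P <= #|F|.
Proof.
move=> satF; rewrite /sat_star; have: F \in index_enum _ := mem_index_enum F.
elim: (index_enum _) => // G r IHr; rewrite inE big_cons => /predU1P[<-|/IHr leF].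
  by rewrite satF geq_minl.
by case: ifP => // _; rewrite geq_min leF orbT.
Qed.

Lemma induced_saturated_ex (x0 : P) :
  exists F : {set {set 'I_n}}, induced_saturated P F.
Proof.
have free0 : ~~ has_induced_copy P (set0 : {set {set 'I_n}}).
  apply/negP => /existsP[f /and3P[_ /forallP/(_ x0)]].
  by rewrite inE.
have [F maxF _] := @maxset_exists _ (fun F : {set {set 'I_n}} => ~~ has_induced_copy P F) set0 free0.
exists F; rewrite /induced_saturated (maxsetp maxF) /=.
apply/forallP => X; apply/implyP => XF; apply: (contraNT _ XF) => freeXF.
rewrite -(maxsetsup maxF freeXF (subsetUr _ _)).
exact: setU11.
Qed.

Lemma sat_starP (x0 : P) :
  exists2 F : {set {set 'I_n}}, induced_saturated P F & #|F| = sat_star n P.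
Proof.
have [F0 satF0] := induced_saturated_ex x0.
have [F satF minF] := arg_minnP (fun F : {set {set 'I_n}} => #|F|) satF0.
exists F => //; apply/eqP; rewrite eqn_leq sat_star_le // andbT.
rewrite /sat_star; apply: (big_ind (fun m => #|F| <= m)) => [|a b Fa Fb|].
- by rewrite (leq_trans (max_card _)) // -cardsT -powersetT card_powerset cardsT card_ord.
- by rewrite leq_min Fa.
- exact: minF.
Qed.

End SatStarSpec.

(* inl is the upper layer and inr the lower layer. *)
Definition complete_bipartite (s t : nat) : Type := ('I_s + 'I_t)%type.

Section CompleteBipartite.
Variables s t : nat.
Local Notation K := (complete_bipartite s t).

HB.instance Definition _ := Finite.on K.

Definition complete_bipartite_le (x y : K) : bool :=
  (x == y) || (if (x, y) is (inr _, inl _) then true else false).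

Fact complete_bipartite_le_refl : reflexive complete_bipartite_le.
Proof. by move=> x; rewrite /complete_bipartite_le eqxx. Qed.

Fact complete_bipartite_le_anti : antisymmetric complete_bipartite_le.
Proof.
move=> x y /andP[/orP[/eqP //|lexy] /orP[/eqP //|]].
by case: x y lexy => [i|i] [j|j].
Qed.

Fact complete_bipartite_le_trans : transitive complete_bipartite_le.
Proof.
move=> y x z /orP[/eqP-> //|lexy] /orP[/eqP<-|leyz].
  by rewrite /complete_bipartite_le lexy orbT.
by case: x y z lexy leyz => [i|i] [j|j] [k|k].
Qed.

End CompleteBipartite.

Fact complete_bipartite_display : Order.disp_t.
Proof. exact: Order.Disp tt tt. Qed.

HB.instance Definition _ (s t : nat) :=
  Order.Le_isPOrder.Build complete_bipartite_display (complete_bipartite s t)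
    (@complete_bipartite_le_refl s t) (@complete_bipartite_le_anti s t)
    (@complete_bipartite_le_trans s t).

(* Main.v *)
(* Call X "covered" when F contains an antichain of s supersets of X; F is then
   K_{s,2}-free iff no two incomparable members of F have a covered union.
   Given x, if {x} is not covered then saturation forces {x} into F. Otherwise
   take A in F maximal such that x is not in A and A + x is covered: saturation
   and the maximality of A force A + x into F. The members A + x of F so
   obtained are distinct for distinct x, since A + x = B + y with x <> y would
   make A and B incomparable with the covered union A + x. Together with the
   empty set, which is always in F, this makes n + 1 members. *)
Require Import Defs.
From mathcomp Require Import all_boot all_order.

Set Implicit Arguments.
Unset Strict Implicit.
Unset Printing Implicit Defensive.

Import Order.DefaultSetSubsetOrder.

(** The single implication makes the [U i] both distinct and pairwise incomparable. For [s = 0]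
    every set is covered. *)
Definition covered (n s : nat) (F : {set {set 'I_n}}) (X : {set 'I_n}) : bool :=
  [exists U : {ffun 'I_s -> {set 'I_n}},
    [forall i, (U i \in F) && (X \subset U i)]
      && [forall i, forall j, (U i \subset U j) ==> (i == j)]].

Definition incomparable (n : nat) (A B : {set 'I_n}) : bool :=
  ~~ (A \subset B) && ~~ (B \subset A).

Lemma coveredP (n s : nat) (F : {set {set 'I_n}}) (X : {set 'I_n}) :
  reflect (exists U : 'I_s -> {set 'I_n},
             [/\ forall i, U i \in F, forall i, X \subset U i
               & forall i j, U i \subset U j -> i = j])
          (covered s F X).
Proof.
apply: (iffP existsP) => [[U /andP[/forallP FXU /forallP antiU]]|[U [FU XU antiU]]].
  exists U; split=> [i|i|i j Uij]; try by have /andP[] := FXU i.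
  by apply/eqP; move/forallP: (antiU i) => /(_ j); rewrite Uij.
exists (finfun U); apply/andP; split; apply/forallP=> i.
  by rewrite ffunE FU XU.
by apply/forallP=> j; rewrite !ffunE; apply/implyP=> /antiU->.
Qed.

Lemma covered_sub (n s : nat) (F : {set {set 'I_n}}) (X Y : {set 'I_n}) :
  X \subset Y -> covered s F Y -> covered s F X.
Proof.
move=> XY /coveredP[U [FU YU antiU]]; apply/coveredP; exists U; split=> // i.
exact: subset_trans XY (YU i).
Qed.

Section Saturated.

Context (n s : nat) (F : {set {set 'I_n}}).

Local Notation K := (complete_bipartite s 2).
Local Notation covered := (covered s F).

(** [A] and [B] form the lower layer and the covering antichain the upper one. No [U i] lies inside
    [A], since then [B] would too, and symmetrically for [B]. *)
Lemma copy_of_covered (A B : {set 'I_n}) :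
  A \in F -> B \in F -> incomparable A B -> covered (A :|: B) ->
  has_induced_copy K F.
Proof.
move=> FA FB /andP[nAB nBA] /coveredP[U [FU ABU antiU]].
have AU i : A \subset U i by rewrite (subset_trans _ (ABU i)) ?subsetUl.
have BU i : B \subset U i by rewrite (subset_trans _ (ABU i)) ?subsetUr.
have nUA i : ~~ (U i \subset A).
  by apply: contra nBA => UA; apply: subset_trans (BU i) UA.
have nUB i : ~~ (U i \subset B).
  by apply: contra nAB => UB; apply: subset_trans (AU i) UB.
pose g (x : K) := match x with inl i => U i | inr j => if j == ord0 then A else B end.
have gE x y : (g x \subset g y) = (x <= y)%O.
  rewrite /Order.le /= /complete_bipartite_le.
  case: x y => [i|i] [j|j] /=; rewrite ?orbF.
  - by apply/idP/eqP => [/antiU->|[->]].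
  - by case: ifP => _; apply/negbTE.
  - by case: ifP; rewrite ?AU ?BU.
  case: i j => [[|[|//]] ?] [[|[|//]] ?] /=; rewrite ?subxx.
  - by apply/esym/eqP; congr inr; apply: val_inj.
  - by rewrite (negbTE nAB).
  - by rewrite (negbTE nBA).
  by apply/esym/eqP; congr inr; apply: val_inj.
apply/existsP; exists (finfun g); apply/and3P; split.
- apply/injectiveP=> x y; rewrite !ffunE => gxy.
  by apply: Order.POrderTheory.le_anti; rewrite -!gE gxy subxx.
- by apply/forallP=> -[i|i]; rewrite ffunE /=; last case: ifP.
by apply/forallP=> x; apply/forallP=> y; rewrite !ffunE -gE Order.SetSubsetOrder.leEsubset.
Qed.

Hypothesis satF : induced_saturated K F.

Lemma saturated_free (A B : {set 'I_n}) :
  A \in F -> B \in F -> incomparable A B -> ~~ covered (A :|: B).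
Proof.
move=> FA FB AB; have /andP[+ _] := satF; apply: contra.
exact: copy_of_covered FA FB AB.
Qed.

(* The two cases are those of a new copy with X in its lower or upper layer. *)
Lemma saturated_notin (X : {set 'I_n}) : X \notin F ->
  (exists Y, [/\ Y \in F, incomparable X Y & covered (X :|: Y)]) \/
  (exists A B, [/\ A \in F, B \in F, incomparable A B & A :|: B \subset X]).
Proof.
move=> nFX; have /andP[nF /forallP/(_ X)] := satF; rewrite nFX /=.
case/existsP=> f /and3P[/injectiveP f_inj /forallP fXF /forallP fE].
have leE x y : (f x \subset f y) = (x <= y)%O.
  by move/forallP: (fE x) => /(_ y)/eqP <-; rewrite Order.SetSubsetOrder.leEsubset.
have antiU i j : f (inl i) \subset f (inl j) -> i = j.
  by rewrite leE /Order.le /= /complete_bipartite_le orbF => /eqP[].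
have lowU i j : f (inr j) \subset f (inl i).
  by rewrite leE /Order.le /= /complete_bipartite_le orbT.
have incL j k : j != k -> incomparable (f (inr j)) (f (inr k)).
  move=> jk; rewrite /incomparable !leE /Order.le /=.
  rewrite /complete_bipartite_le !orbF.
  by apply/andP; split; apply: contra jk => /eqP[->].
have inF x y : f x = X -> y != x -> f y \in F.
  by move=> fx yx; have := fXF y; rewrite in_setU1 -fx (inj_eq f_inj) (negbTE yx).
have covL j k : (forall i, f (inl i) \in F) -> covered (f (inr j) :|: f (inr k)).
  move=> FU; apply/coveredP; exists (fun i => f (inl i)); split=> // i.
  by rewrite subUset !lowU.
have [/existsP[j /eqP fj]|nX] := boolP [exists j, f (inr j) == X].
  (* [X] is a lower element and [k] indexes the other one; injectivity puts the rest of the copy in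
     [F]. *)
  left; pose k : 'I_2 := if j == ord0 then ord_max else ord0.
  have kj : k != j by rewrite /k; case: ifP => [/eqP->|/negbT] //; rewrite eq_sym.
  exists (f (inr k)); split; first exact: inF fj _.
    by rewrite -fj incL // eq_sym.
  by rewrite -fj; apply: covL => i; apply: inF fj _.
have FL j : f (inr j) \in F.
  have := fXF (inr j); rewrite in_setU1 => /predU1P[fj|//].
  by case/existsP: nX; exists j; apply/eqP.
have inc01 := incL ord0 ord_max isT.
have [/existsP[i /eqP fi]|nXU] := boolP [exists i, f (inl i) == X].
  right; exists (f (inr ord0)), (f (inr ord_max)).
  by split; [exact: FL | exact: FL | exact: inc01 | rewrite -fi subUset !lowU].
(* Here the copy avoids [X], so it lies within [F], which is [K]-free. *)
case/negP: nF; apply: copy_of_covered (FL ord0) (FL ord_max) inc01 _.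
apply: covL => i; have := fXF (inl i); rewrite in_setU1 => /predU1P[fi|//].
by case/existsP: nXU; exists i; apply/eqP.
Qed.

(** The empty set is comparable to every set and contains no two incomparable sets, so adding it
    cannot create a copy. *)
Lemma saturated_set0 : set0 \in F.
Proof.
apply/negPn/negP => /saturated_notin[[Y [_ /andP[]]]|[A [B [_ _ /andP[nAB _]]]]].
  by rewrite sub0set.
by rewrite subUset => /andP[/subset_trans/(_ (sub0set B)) AB]; rewrite AB in nAB.
Qed.

(** The only subsets of a singleton are itself and the empty set, which are comparable, so [[set x]]
    could only enter a copy in the lower layer. *)
Lemma saturated_set1 (x : 'I_n) : ~~ covered [set x] -> [set x] \in F.
Proof.
move=> ncx; apply/negPn/negP => /saturated_notin[[Y [_ _ cxY]]|[A [B [_ _]]]].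
  by case/negP: ncx; apply: covered_sub cxY; apply: subsetUl.
case/andP=> nAB nBA; rewrite subUset !subset1.
by case/andP=> /orP[]/eqP eA /orP[]/eqP eB; rewrite eA eB ?subxx ?sub0set in nAB nBA.
Qed.

Lemma saturated_extension (x : 'I_n) :
  exists A, [/\ A \in F, x \notin A, x |: A \in F & (A == set0) || covered (x |: A)].
Proof.
have [cx|/saturated_set1 Fx] := boolP (covered [set x]); last first.
  by exists set0; rewrite setU0 eqxx saturated_set0 in_set0.
pose P (A : {set 'I_n}) := [&& A \in F, x \notin A & covered (x |: A)].
have P0 : P set0 by rewrite /P saturated_set0 in_set0 setU0.
have [A /and3P[FA xA cA] maxA] := @arg_maxnP _ set0 P (fun A => #|A|) P0.
exists A; rewrite cA orbT; split=> //.
apply/negPn/negP => /saturated_notin[[Y [FY /andP[nxAY nYxA] cY]]|[B [C [FB FC BC BCxA]]]].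
  (* If [A] is inside [Y], then [Y] is itself a candidate for the maximum and must equal [A];
     otherwise [A] and [Y] are incomparable members of [F] with a covered union. *)
  have [AY|nAY] := boolP (A \subset Y).
    have xY : x \notin Y by apply: contra nxAY => xY; rewrite subUset sub1set xY.
    have PY : P Y by rewrite /P FY xY; move: cY; rewrite -setUA (setUidPr AY).
    have /eqP eAY : A == Y by rewrite eqEcard AY; apply: maxA.
    by rewrite -eAY subsetUr in nYxA.
  have nYA : ~~ (Y \subset A).
    by apply: contra nYxA => /subset_trans-> //; apply: subsetUr.
  have /negP[] : ~~ covered (A :|: Y) by apply: saturated_free => //; apply/andP.
  by apply: covered_sub cY; rewrite -setUA subsetUr.
by case/negP: (saturated_free FB FC BC); apply: covered_sub BCxA cA.
Qed.

Lemma saturated_card : n < #|F|.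
Proof.
have [A FA] := fin_all_exists saturated_extension.
pose g x := x |: A x.
(* In this case [g x] is the singleton of [x], and it contains [y] because [g y] does. *)
have ext0 x y : A x = set0 -> g x = g y -> x = y.
  by rewrite /g => -> /setP/(_ y); rewrite setU0 !inE eqxx /= => /eqP.
have g_inj : injective g.
  move=> x y gxy; have [FAx xAx _ /orP[/eqP Ax|cgx]] := FA x; first exact: ext0 gxy.
  apply/eqP/negPn/negP => xy; have [FAy yAy _ _] := FA y.
  have yAx : y \in A x.
    by have := setU11 y (A y); rewrite -/(g y) -gxy in_setU1 eq_sym (negbTE xy).
  have xAy : x \in A y.
    by have := setU11 x (A x); rewrite -/(g x) gxy in_setU1 (negbTE xy).
  have inc : incomparable (A x) (A y).
    apply/andP; split; first by apply: contra yAy => /subsetP->.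
    by apply: contra xAx => /subsetP->.
  case/negP: (saturated_free FAx FAy inc); apply: covered_sub cgx.
  by rewrite subUset subsetUr /= -/(g x) gxy subsetUr.
have set0Ng : set0 \notin [set g x | x : 'I_n].
  by apply/imsetP => -[x _ /setP/(_ x)]; rewrite in_set0 setU11.
have -> : n.+1 = #|set0 |: [set g x | x : 'I_n]|.
  by rewrite cardsU1 set0Ng card_imset // card_ord.
apply: subset_leq_card; rewrite subUset sub1set saturated_set0 /=.
by apply/subsetP=> _ /imsetP[x _ ->]; have [] := FA x.
Qed.

End Saturated.

Theorem theorem2 (n s : nat) :
  sat_star n (complete_bipartite s 2) >= n + 1.
Proof.
(* The bound must also hold for the default value of the minimum, hence the goal [n < 2 ^ n]. *)
rewrite addn1 /sat_star; apply: (big_ind (fun m => n < m)) => [|a b na nb|F].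
- exact: ltn_expl.
- by rewrite leq_min na.
exact: saturated_card.
Qed.
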